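(* Let $a$ be a nonzero real constant. For $i=1,\ldots,N$, the residual $$u(t) = -2a\,\frac{z_i - e^{a(t_i-t_{i-1})}z_{i-1}}{1 - e^{2a(t_i-t_{i-1})}}\,e^{a(t_i-t)},$$ for all $t\in[t_{i-1},t_i]$, solves Problem (PL2) with $f(x(t),t)=a\,x(t)$. The resulting interpolant is given by $$x(t) = -\frac{z_i - e^{-a(t_i-t_{i-1})} z_{i-1}}{e^{-a(t_i-t_{i-1})} - e^{a(t_i-t_{i-1})}}\,e^{a(t-t_{i-1})} - \frac{1}{2a}\,u(t),$$ for all $t\in[t_{i-1},t_i]$.
   Context: Let $0=t_0<t_1<\cdots<t_N=:t_f$ and let $z_0,\ldots,z_N\in\mathbb{R}$ (the skeleton) satisfy $z_i\ne z_{i-1}$, $i=1,\ldots,N$. The underlying ODE is the Dahlquist test problem $\dot z(t)=a\,z(t)$, $z(0)=z_0$. Problem (PL2) for scalar $f$: minimize $\frac12\sum_{i=1}^N\int_{t_{i-1}}^{t_i}|\dot x(t)-f(x(t),t)|^2dt$ over $x\in W^{1,\infty}(t_0,t_f;\mathbb{R})$ subject to $x(t_i)=z_i$, $i=0,\ldots,N$. The residual of $x$ is $u(t):=\dot x(t)-f(x(t),t)$; equivalently, minimize $\frac12\sum_{i=1}^N\int_{t_{i-1}}^{t_i}|u(t)|^2dt$ over $(x,u)$ with $\dot x=f(x,t)+u$ a.e. and $x(t_i)=z_i$. The residual $u$ may jump at the nodes $t_1,\ldots,t_{N-1}$; the formulas are to be read separately on each stage $[t_{i-1},t_i]$. *)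

(* Defs.v *)
From mathcomp Require Export all_boot all_order all_algebra.
From mathcomp Require Export all_classical all_reals all_analysis.
Export numFieldNormedType.Exports.

Set Implicit Arguments.
Unset Strict Implicit.
Unset Printing Implicit Defensive.
Import Order.TTheory GRing.Theory Num.Theory.
Local Open Scope classical_set_scope.
Local Open Scope ring_scope.

Definition in_Linfty (R : realType) (a b : R) (g : R -> R) : Prop :=
  g \_ `]a, b[ \in Lfun (@lebesgue_measure R) +oo%E.

(* phi belongs to C^1_c(]a, b[) *)
Definition test_function (R : realType) (a b : R) (phi : R -> R) : Prop :=
  [/\ forall s, derivable phi s 1,
      continuous (phi^`()%classic)
    & exists K : set R,
        [/\ compact K, K `<=` `]a, b[ & forall s, ~ K s -> phi s = 0]].

Definition weak_derivative (R : realType) (a b : R) (x g : R -> R) : Prop :=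
  forall phi : R -> R, test_function a b phi ->
    (\int[@lebesgue_measure R]_(s in `]a, b[) (x s * (phi^`()%classic s))%:E =
     - \int[@lebesgue_measure R]_(s in `]a, b[) (g s * phi s)%:E)%E.

(* Elements of W^{1,oo}(a, b) are taken to be their continuous representatives
   on [a, b], so that the point values x (t i) are meaningful; the values of x
   outside [a, b] are irrelevant. *)
Definition W1infty (R : realType) (a b : R) (x : R -> R) : Prop :=
  [/\ {within `[a, b], continuous x},
      in_Linfty a b x
    & exists g, in_Linfty a b g /\ weak_derivative a b x g].

(* A choice of xdot, unique up to a null subset of ]a, b[; it is only meaningful
   for x in W1infty a b. *)
Definition wderiv (R : realType) (a b : R) (x : R -> R) : R -> R :=
  xget (cst 0) [set g | in_Linfty a b g /\ weak_derivative a b x g].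

Definition residual (R : realType) (f : R -> R -> R) (a b : R) (x : R -> R)
    (s : R) : R :=
  wderiv a b x s - f (x s) s.

(* Only the entries 0, ..., N of the sequences t and z are used; the stages
   [t_(i-1), t_i] for i = 1, ..., N are `[t i, t i.+1] for i < N. *)
Definition PL2_feasible (R : realType) (N : nat) (t z : nat -> R)
    (x : R -> R) : Prop :=
  W1infty (t 0%N) (t N) x /\ forall i, (i <= N)%N -> x (t i) = z i.

Definition PL2_cost (R : realType) (N : nat) (t : nat -> R)
    (f : R -> R -> R) (x : R -> R) : \bar R :=
  ((2^-1)%:E * \sum_(i < N)
     \int[@lebesgue_measure R]_(s in `[t i, t i.+1])
       (`|residual f (t 0%N) (t N) x s| ^+ 2)%:E)%E.

Definition PL2_solution (R : realType) (N : nat) (t z : nat -> R)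
    (f : R -> R -> R) (x : R -> R) : Prop :=
  PL2_feasible N t z x /\
  forall y, PL2_feasible N t z y -> (PL2_cost N t f x <= PL2_cost N t f y)%E.

(* x has residual u i on the i-th stage, i.e., xdot = f(x, .) + u i a.e. there;
   there is one function per stage because the residual may jump at nodes. *)
Definition has_residual (R : realType) (N : nat) (t : nat -> R)
    (f : R -> R -> R) (x : R -> R) (u : nat -> R -> R) : Prop :=
  forall i, (i < N)%N ->
    {ae @lebesgue_measure R, forall s, s \in `[t i, t i.+1] ->
       residual f (t 0%N) (t N) x s = u i s}.

(* Main.v *)
Require Import Defs.
From mathcomp Require Import ring lra ess_sup_inf measurable_realfun.
Set Implicit Arguments.
Unset Strict Implicit.
Unset Printing Implicit Defensive.
Import Order.TTheory GRing.Theory Num.Theory.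
Local Open Scope classical_set_scope.
Local Open Scope ring_scope.

(* For a feasible y with residual v, the weak derivative satisfies
   (exp(-a s) y)' = exp(-a s) v. Testing it against C^1 functions that approximate
   the indicator of a stage gives the integrated identity
     exp(-a s) y(s) - exp(-a r) y(r) = int_r^s exp(-a tau) v(tau) dtau.
   The proposed residual u is on each stage a multiple of exp(-a s), and the
   nodal values of y are prescribed, so int u (v - u) = 0 on each stage, whence
   int v^2 >= int u^2. The same identity shows that a feasible function is
   determined by its residual. *)

Lemma is_derive_continuous (R : realType) (f g : R -> R) :
  (forall s : R, is_derive s 1 f (g s)) -> continuous f.
Proof.
move=> fg s; apply: differentiable_continuous; apply/derivable1_diffP.
by have [] := fg s.
Qed.

(** * Continuously differentiable approximations of the Heaviside step *)

Section smooth_step.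
Context {R : realType}.
Implicit Types (p e s v w : R).

(** Second-order Taylor bound for [w * |w|], which is quadratic on each side of 0 with second
    derivative 2 or -2. *)
Lemma normM_taylor (v w : R) : `|w * `|w| - v * `|v| - 2 * `|v| * (w - v)| <= (w - v) ^+ 2.
Proof.
have w2 := sqr_ge0 w; have v2 := sqr_ge0 v; have wv2 := sqr_ge0 (w - v).
have := mulr_ge0 (normr_ge0 w) (normr_ge0 v).
rewrite ler_norml !expr2 in w2 v2 wv2 *.
case: (ger0P v); case: (ger0P w) => *; apply/andP; split; nra.
Qed.

(** In Caratheodory form: by the Taylor bound, the difference quotient is within [|w - v|] of
    [2 * |v|]. This is the C^1 building block of [step]. *)
Lemma is_derive_mul_norm v : is_derive v 1 (fun w => w * `|w|) (2 * `|v|).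
Proof.
apply/is_derive1_caratheodory.
exists (fun w => if w == v then 2 * `|v| else (w * `|w| - v * `|v|) / (w - v)).
split; last by rewrite eqxx.
  move=> w; case: eqP => [->|/eqP]; first by rewrite !subrr mulr0.
  by rewrite -subr_eq0 => /divfK->.
apply/cvgrPdist_le => /= e e0; near=> w; rewrite eqxx.
case: eqVneq => [_|wv]; first by rewrite subrr normr0 ltW.
have wv0 : w - v != 0 by rewrite subr_eq0.
rewrite distrC (_ : _ - _ = (w * `|w| - v * `|v| - 2 * `|v| * (w - v)) / (w - v)); last first.
  by field.
rewrite normrM normfV ler_pdivrMr ?normr_gt0//.
apply: le_trans (normM_taylor _ _) _.
rewrite -[leLHS]ger0_norm ?sqr_ge0// normrX expr2.
apply: ler_wpM2r; first exact: normr_ge0.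
by rewrite distrC; near: w; exact: cvgr_dist_le.
Unshelve. all: by end_near. Qed.

(* The antiderivative of the tent function with support [0, 1] and height 2. *)
Definition step v : R :=
  v * `|v| - 2 * ((v - 2^-1) * `|v - 2^-1|) + (v - 1) * `|v - 1| + 2^-1.

(** The weights 2, -4, 2 at 0, 1/2, 1 annihilate affine functions, so the three kinks cancel outside
    [0, 1]. *)
Definition tent v : R := 2 * `|v| - 4 * `|v - 2^-1| + 2 * `|v - 1|.

Lemma is_derive_step v : is_derive v 1 step (tent v).
Proof.
pose k (c w : R) : R^o := (w - c) * `|w - c|.
have d c : is_derive v 1 (k c) (2 * `|v - c|).
  have := @is_derive1_comp R _ (center c) v _ _
    (is_derive_mul_norm (v - c)) (is_derive_shift v 1 (- c)).
  by rewrite mulr1.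
rewrite (_ : step = k 0 - 2 \*: k 2^-1 + k 1 + cst 2^-1); last first.
  by apply/funext => w; rewrite /step !fctE /k subr0.
apply: is_derive_eq; rewrite /tent subr0.
by rewrite /GRing.scale/= ; ring.
Qed.

Lemma step_le0 v : v <= 0 -> step v = 0.
Proof. by move=> v0; rewrite /step !ler0_norm; [field|lra..]. Qed.

Lemma step_ge1 v : 1 <= v -> step v = 1.
Proof. by move=> v0; rewrite /step !ger0_norm; [field|lra..]. Qed.

Lemma step_itv v : 0 <= step v <= 1.
Proof.
rewrite /step; have h2 : 2 * 2^-1 = 1 :> R by rewrite mulfV.
set h := 2^-1 in h2 *.
by case: (ger0P v); case: (ger0P (v - h)); case: (ger0P (v - 1)) => ? ? ?;
  apply/andP; split; nra.
Qed.

Lemma tent_ge0 v : 0 <= tent v.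
Proof.
rewrite /tent; have h2 : 2 * 2^-1 = 1 :> R by rewrite mulfV.
set h := 2^-1 in h2 *.
by case: (ger0P v); case: (ger0P (v - h)); case: (ger0P (v - 1)) => ? ? ?; lra.
Qed.

Lemma tent_out v : ~~ (0 <= v <= 1) -> tent v = 0.
Proof.
rewrite /tent; have h2 : 2 * 2^-1 = 1 :> R by rewrite mulfV.
set h := 2^-1 in h2 *.
by case: (ger0P v); case: (ger0P (v - h)); case: (ger0P (v - 1)) => ? ? ?; lra.
Qed.

Lemma continuous_tent : continuous tent.
Proof.
move=> v; rewrite /tent; apply: cvgD; first apply: cvgB.
- by apply: cvgMr; apply: cvg_norm; exact: cvg_id.
- by apply: cvgMr; apply: cvg_norm; apply: cvgB; [exact: cvg_id|exact: cvg_cst].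
- by apply: cvgMr; apply: cvg_norm; apply: cvgB; [exact: cvg_id|exact: cvg_cst].
Qed.

(** For [e > 0] this rises from 0 at [p] to 1 at [p + e]. Its derivative [stent] is an approximate
    Dirac mass: nonnegative, supported in [[p, p + e]], of integral 1. *)
Definition sstep p e s : R := step ((s - p) / e).
Definition stent p e s : R := tent ((s - p) / e) / e.

Lemma is_derive_sstep p e s : is_derive s 1 (sstep p e) (stent p e s).
Proof.
have h : is_derive s 1 (fun s => (s - p) / e) e^-1.
  have := is_deriveZ e^-1 (is_derive_shift s 1 (- p)).
  rewrite /GRing.scale/= mulr1; congr is_derive.
  by apply/funext => w; exact: mulrC.
exact: @is_derive1_comp R step _ s _ _ (is_derive_step ((s - p) / e)) h.
Qed.

Lemma continuous_stent p e : continuous (stent p e).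
Proof.
move=> s; apply: cvgMl; apply: (@continuous_comp _ _ _ (fun s => (s - p) / e) tent).
  by apply: cvgMl; apply: cvgB; [exact: cvg_id|exact: cvg_cst].
exact: continuous_tent.
Qed.

Lemma sstep_left p e s : 0 < e -> s <= p -> sstep p e s = 0.
Proof. by move=> e0 sp; rewrite /sstep step_le0// pmulr_lle0 ?invr_gt0// subr_le0. Qed.

Lemma sstep_right p e s : 0 < e -> p + e <= s -> sstep p e s = 1.
Proof. by move=> e0 sp; rewrite /sstep step_ge1// ler_pdivlMr// mul1r lerBrDl. Qed.

Lemma sstep_itv p e s : 0 <= sstep p e s <= 1.
Proof. exact: step_itv. Qed.

Lemma stent_ge0 p e s : 0 < e -> 0 <= stent p e s.
Proof. by move=> e0; rewrite divr_ge0 ?tent_ge0// ltW. Qed.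

Lemma stent_out p e s : 0 < e -> ~~ (p <= s <= p + e) -> stent p e s = 0.
Proof.
move=> e0 sp; rewrite /stent tent_out ?mul0r//; apply: contra sp.
by rewrite ler_pdivrMr// mul1r pmulr_lge0 ?invr_gt0// subr_ge0 lerBlDl.
Qed.

End smooth_step.

(** * Essentially bounded functions and integrals on open intervals *)

Section open_interval_integral.
Context {R : realType}.
Local Notation mu := (@lebesgue_measure R).
Implicit Types (a b : R) (f g h k : R -> R).

Lemma aeS (P Q : set R) : P `<=` Q ->
  {ae mu, forall s, P s} -> {ae mu, forall s, Q s}.
Proof. by apply: filterS; exact: (ae_filter_ringOfSetsType mu). Qed.

Lemma aeS2 (P Q S : set R) : (forall s, P s -> Q s -> S s) ->
  {ae mu, forall s, P s} -> {ae mu, forall s, Q s} -> {ae mu, forall s, S s}.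
Proof. by apply: filterS2; exact: (ae_filter_ringOfSetsType mu). Qed.

(** Replaces the essential supremum norm of the restriction by measurability and an almost
    everywhere bound, the form in which closure properties are immediate. *)
Lemma in_LinftyP a b g : in_Linfty a b g <->
  measurable_fun `]a, b[ g /\
  exists M : R, {ae mu, forall s, a < s < b -> `|g s| <= M}.
Proof.
(* The norm of exponent [+oo] is an essential supremum only when the whole space has positive
   measure; []0, 1[] witnesses this. *)
have muT : (0 < mu [set: R])%E.
  apply: (@lt_le_trans _ _ (mu `]0, 1[)); last by apply: le_measure; rewrite ?inE.
  by rewrite lebesgue_measure_itv/= lte_fin ltr01 -EFinB subr0 lte_fin.
rewrite /in_Linfty inE; split.
  move=> /andP[/[!inE]/= mg]; rewrite /finite_norm unlock muT => gM.
  split; first by apply/measurable_restrictT.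
  have [M gMM] := @ess_supr_bounded _ _ _ mu (Num.norm \o (g \_ `]a, b[)) gM.
  exists M; apply: aeS gMM => s /= gs sab.
  by move: gs; rewrite patchE mem_set//= in_itv.
move=> [mg [M gM]]; apply/andP; split; rewrite inE/=.
  exact/(measurable_restrictT _ _).1.
rewrite /finite_norm unlock muT (@le_lt_trans _ _ `|M|%:E)// ?ltry//.
apply/ess_supP; apply: aeS gM => s /= gs.
rewrite lee_fin patchE; case: ifPn; last by rewrite normr0.
by rewrite inE/= in_itv/= => /gs /le_trans; apply; exact: ler_norm.
Qed.

Lemma in_Linfty_integrable a b g : in_Linfty a b g ->
  mu.-integrable `]a, b[ (EFin \o g).
Proof.
move=> /in_LinftyP[mg [M gM]]; apply/integrableP; split.
  exact/measurable_EFinP.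
apply: (@le_lt_trans _ _ (\int[mu]_(s in `]a, b[) (cst `|M|%:E) s)%E).
  apply: ae_ge0_le_integral => //.
    by apply/measurable_EFinP; exact: measurableT_comp.
    by move=> s _; rewrite lee_fin.
  apply: aeS gM => s /= gs; rewrite in_itv/= => /gs sM.
  by rewrite lee_fin (le_trans sM)// ler_norm.
rewrite integral_cst//= lebesgue_measure_itv/=.
by case: ifPn => _; rewrite -?EFinB -?EFinM ltry.
Qed.

Lemma in_LinftyB a b g h : in_Linfty a b g -> in_Linfty a b h ->
  in_Linfty a b (fun s => g s - h s).
Proof.
move=> /in_LinftyP[mg [M gM]] /in_LinftyP[mh [N hN]]; apply/in_LinftyP; split.
  exact: measurable_funB.
exists (M + N); apply: aeS2 gM hN => s gs hs sab.
by rewrite (le_trans (ler_normB _ _))// lerD ?gs ?hs.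
Qed.

Lemma in_LinftyD a b g h : in_Linfty a b g -> in_Linfty a b h ->
  in_Linfty a b (fun s => g s + h s).
Proof.
move=> /in_LinftyP[mg [M gM]] /in_LinftyP[mh [N hN]]; apply/in_LinftyP; split.
  exact: measurable_funD.
exists (M + N); apply: aeS2 gM hN => s gs hs sab.
by rewrite (le_trans (ler_normD _ _))// lerD ?gs ?hs.
Qed.

Lemma in_LinftyM a b g h : in_Linfty a b g -> in_Linfty a b h ->
  in_Linfty a b (fun s => g s * h s).
Proof.
move=> /in_LinftyP[mg [M gM]] /in_LinftyP[mh [N hN]]; apply/in_LinftyP; split.
  exact: measurable_funM.
exists (M * N); apply: aeS2 gM hN => s gs hs sab.
by rewrite normrM ler_pM ?gs ?hs.
Qed.

Lemma in_LinftyS a b c d g : a <= c -> d <= b -> in_Linfty a b g ->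
  in_Linfty c d g.
Proof.
move=> ac db /in_LinftyP[mg [M gM]]; apply/in_LinftyP; split.
  by apply: measurable_funS mg => //; apply: subset_itv; rewrite bnd_simp.
exists M; apply: aeS gM => s gs /andP[cs sd]; apply: gs.
by rewrite (le_lt_trans ac)//= (lt_le_trans sd).
Qed.

Lemma within_continuous_in_Linfty a b f : {within `[a, b], continuous f} ->
  in_Linfty a b f.
Proof.
move=> cf; apply/in_LinftyP; split.
  apply: (measurable_funS (E := `[a, b])) => //; first exact: subset_itv_oo_cc.
  exact: subspace_continuous_measurable_fun.
have /compact_bounded[M [_ fM]] := continuous_compact cf (@segment_compact _ a b).
(* [compact_bounded] only gives bounds strictly above [M]. *)
exists (`|M| + 1); apply: aeW => s sab; apply: (fM (`|M| + 1)).
  by rewrite (le_lt_trans (ler_norm _))// ltrDl.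
by exists s => //=; rewrite in_itv/=; case/andP: sab => /ltW -> /ltW ->.
Qed.

Lemma continuous_in_Linfty a b f : continuous f -> in_Linfty a b f.
Proof.
by move=> cf; apply: within_continuous_in_Linfty; exact: continuous_subspaceT.
Qed.

Lemma Rintegral_FTC f g a b : a < b -> (forall s : R, is_derive s 1 f (g s)) ->
  continuous g -> \int[mu]_(s in `]a, b[) g s = f b - f a.
Proof.
move=> ab fg cg; rewrite /Rintegral -(@integral_itv_bndoo _ _ _ _ true false); last first.
  apply/measurable_EFinP; apply: measurable_funTS.
  exact: continuous_measurable_fun.
rewrite (@continuous_FTC2 _ g f)// ?fineB//.
- exact: continuous_subspaceT.
- have df s : derivable f s 1 by [].
  have cf := is_derive_continuous fg.
  split => // .
  + exact/cvg_at_right_filter/cf.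
  + exact/cvg_at_left_filter/cf.
- by move=> s _; rewrite derive1E; exact: derive_val.
Qed.

End open_interval_integral.

(** * Integration by parts for weak derivatives, up to the endpoints *)

Section weak_integration_by_parts.
Context {R : realType}.
Local Notation mu := (@lebesgue_measure R).
Implicit Types (A B : R) (x g h psi dpsi : R -> R).

(** Since [stent p e] is nonnegative with integral 1, the integral is a weighted mean of [h] over
    [[p, p + e]], and [c] is the same mean of a constant. *)
Lemma Rintegral_stent_dist A B h c d p e : 0 < e -> A <= p -> p + e <= B ->
  in_Linfty A B h -> (forall s, p <= s <= p + e -> `|h s - c| <= d) ->
  `|\int[mu]_(s in `]A, B[) (h s * stent p e s) - c| <= d.
Proof.
move=> e0 Ap peB hAB hcd; have AB : A < B by lra.
have st := continuous_in_Linfty A B (@continuous_stent R p e).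
have cL k : in_Linfty A B (cst k) by apply: continuous_in_Linfty; exact: cst_continuous.
have int_st : \int[mu]_(s in `]A, B[) stent p e s = 1.
  rewrite (Rintegral_FTC AB (is_derive_sstep p e) (@continuous_stent R p e)).
  by rewrite sstep_right// sstep_left// subr0.
have ist := in_Linfty_integrable st.
have ih := in_Linfty_integrable (in_LinftyM hAB st).
have ihc : in_Linfty A B (fun s => (h s - c) * stent p e s).
  by apply: in_LinftyM => //; exact: (in_LinftyB hAB (cL c)).
rewrite -[X in _ - X]mulr1 -int_st -RintegralZl// -RintegralB//; last first.
  exact: in_Linfty_integrable (in_LinftyM (cL c) st).
under eq_Rintegral do rewrite -mulrBl.
apply: (le_trans (le_normr_Rintegral _ _)) => //.
  exact: in_Linfty_integrable ihc.
rewrite -[leRHS]mulr1 -int_st -RintegralZl//; apply: le_Rintegral => //.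
- have /in_Linfty_integrable/integrable_abse := ihc; exact.
- exact: in_Linfty_integrable (in_LinftyM (cL d) st).
move=> s _; rewrite normrM (ger0_norm (stent_ge0 _ _ e0)).
have [pse|pse] := boolP (p <= s <= p + e); last by rewrite stent_out// !mulr0.
by rewrite ler_wpM2r ?stent_ge0// hcd.
Qed.

Lemma cvg_Rintegral_stent A B h c (p e : nat -> R) : A <= c <= B ->
  (forall n, 0 < e n) -> (forall n, A <= p n) -> (forall n, p n + e n <= B) ->
  p n @[n --> \oo] --> c -> e n @[n --> \oo] --> 0 ->
  {within `[A, B], continuous h} ->
  \int[mu]_(s in `]A, B[) (h s * stent (p n) (e n) s) @[n --> \oo] --> h c.
Proof.
move=> cAB e0 Ap peB pc ecvg hc; apply/cvgrPdist_le => /= d d0.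
have /subspace_continuousP/(_ c) := hc.
rewrite /= in_itv/= => /(_ cAB) /cvgrPdist_le /(_ d d0).
rewrite near_withinE => /nbhs_ballP[del /= del0 hdel].
(* One half of [del] absorbs the distance from [p n] to [c], the other the width [e n], so the
   support of the kernel falls in the ball around [c]. *)
have del2 : 0 < del / 2 by rewrite divr_gt0.
near=> n.
rewrite distrC; apply: Rintegral_stent_dist => //.
  exact: within_continuous_in_Linfty.
move=> s /andP[ps spe]; rewrite distrC; apply: hdel; last first.
  by rewrite /= in_itv/= (le_trans (Ap n) ps) (le_trans spe (peB n)).
have p1 : `|c - p n| < del / 2 by near: n; move/cvgrPdist_lt : pc; exact.
have e1 : `|0 - e n| < del / 2 by near: n; move/cvgrPdist_lt : ecvg; exact.
rewrite /ball/= ltr_norml; move: p1 e1; rewrite sub0r normrN !ltr_norml.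
by move=> /andP[? ?] /andP[? ?]; apply/andP; split; lra.
Unshelve. all: by end_near. Qed.

(* The weak formulation tested on psi (sstep p e - sstep q e). *)
Lemma weak_derivative_sstep A B x g psi dpsi p q e :
  {within `[A, B], continuous x} -> in_Linfty A B g -> weak_derivative A B x g ->
  (forall s : R, is_derive s 1 psi (dpsi s)) -> continuous dpsi ->
  0 < e -> A < p -> p + e <= q -> q + e < B ->
  \int[mu]_(s in `]A, B[) ((x s * psi s) * stent p e s) -
  \int[mu]_(s in `]A, B[) ((x s * psi s) * stent q e s) +
  \int[mu]_(s in `]A, B[) ((x s * dpsi s + g s * psi s) * (sstep p e s - sstep q e s)) = 0.
Proof.
move=> cx gL xg psiD dpsic e0 Ap peq qeB.
pose phi s := (sstep p e s - sstep q e s) * psi s.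
pose dphi s := (stent p e s - stent q e s) * psi s + (sstep p e s - sstep q e s) * dpsi s.
have phiD (s : R) : is_derive s 1 phi (dphi s).
  have Dp := is_derive_sstep p e s; have Dq := is_derive_sstep q e s.
  have Ds := psiD s.
  rewrite (_ : phi = ((sstep p e - sstep q e) * psi)%R)//.
  apply: is_derive_eq.
  by rewrite /dphi /GRing.scale/= addrC mulrC !fctE.
have dphiE : phi^`()%classic = dphi.
  by apply/funext => s; rewrite derive1E; exact: derive_val.
have psic := is_derive_continuous psiD.
have pc := is_derive_continuous (is_derive_sstep p e).
have qc := is_derive_continuous (is_derive_sstep q e).
have stp := @continuous_stent R p e; have stq := @continuous_stent R q e.
have dphic : continuous dphi.
  by move=> s; apply: cvgD; apply: cvgM; try apply: cvgB;
    [exact: stp|exact: stq|exact: psic|exact: pc|exact: qc|exact: dpsic].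
have tphi : test_function A B phi.
  split.
  - by move=> s; have [] := phiD s.
  - by rewrite dphiE.
  (* Left of [p] both steps are 0 and right of [q + e] both are 1, so their difference vanishes on
     either side. *)
  - exists `[p, q + e]%classic; split; first exact: segment_compact.
    + by apply: subset_itv; rewrite bnd_simp.
    + move=> s /=; rewrite in_itv/= => /negP; rewrite negb_and -!ltNge => /orP[sp|qs].
      * by rewrite /phi !sstep_left ?subrr ?mul0r//; lra.
      * by rewrite /phi !sstep_right ?subrr ?mul0r//; lra.
have /(congr1 fine) := xg _ tphi; rewrite fineN dphiE.
have xL := within_continuous_in_Linfty cx.
have L f (fc : continuous (f : R -> R)) := continuous_in_Linfty A B fc.
have psiL := L _ psic; have dpsiL := L _ dpsic.
have stpL := L _ stp; have stqL := L _ stq.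
have dphiL := L _ dphic; have phiL := L _ (is_derive_continuous phiD).
have chiL := in_LinftyB (L _ pc) (L _ qc).
have hL := in_LinftyM xL psiL.
have kL := in_LinftyD (in_LinftyM xL dpsiL) (in_LinftyM gL psiL).
have I1 := in_Linfty_integrable (in_LinftyM hL stpL).
have I2 := in_Linfty_integrable (in_LinftyM hL stqL).
have I12 := in_Linfty_integrable (in_LinftyB (in_LinftyM hL stpL) (in_LinftyM hL stqL)).
have I3 := in_Linfty_integrable (in_LinftyM kL chiL).
have J1 := in_Linfty_integrable (in_LinftyM xL dphiL).
have J2 := in_Linfty_integrable (in_LinftyM gL phiL).
move=> xgphi; rewrite -RintegralB// -RintegralD//.
transitivity (\int[mu]_(s in `]A, B[) (x s * dphi s + g s * phi s)).
  by apply: eq_Rintegral => s _; rewrite /phi /dphi; ring.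
by rewrite RintegralD// /Rintegral xgphi addNr.
Qed.

(** Plateaus inside []r, s[] increase to its indicator. The two kernel terms tend to the boundary
    values, the plateau term to the integral by dominated convergence. The plateaus keep off [r] and
    [s], so [r = A] and [s = B] are allowed. *)
Lemma weak_derivative_ibp A B x g psi dpsi r s :
  {within `[A, B], continuous x} -> in_Linfty A B g -> weak_derivative A B x g ->
  (forall s : R, is_derive s 1 psi (dpsi s)) -> continuous dpsi ->
  A <= r -> r < s -> s <= B ->
  \int[mu]_(v in `]r, s[) (x v * dpsi v + g v * psi v) = x s * psi s - x r * psi r.
Proof.
move=> cx gL xg psiD dpsic Ar rs sB.
have psic := is_derive_continuous psiD.
pose h v := x v * psi v; pose k v := x v * dpsi v + g v * psi v.
have hc : {within `[A, B], continuous h}.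
  by move=> v; apply: continuousM; [exact: cx|exact: continuous_subspaceT].
have xL := within_continuous_in_Linfty cx.
have kL : in_Linfty A B k.
  by apply: in_LinftyD; apply: in_LinftyM => //; exact: continuous_in_Linfty.
(* The plateau rises on [[r + e, r + 2 e]] and falls on [[s - 2 e, s - e]]; these do not overlap
   because [4 e <= s - r]. *)
pose e n := (s - r) / 4 * n.+1%:R^-1.
have e0 n : 0 < e n by rewrite mulr_gt0// ?divr_gt0// subr_gt0.
have e4 n : e n <= (s - r) / 4.
  by rewrite ler_piMr ?invf_le1 ?ler1n// divr_ge0// subr_ge0 ltW.
have ecvg : e n @[n --> \oo] --> 0.
  by rewrite -[X in _ --> X](mulr0 ((s - r) / 4)); apply: cvgMr; exact: cvg_harmonic.
pose p n := r + e n; pose q n := s - 2 * e n.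
have pcvg : p n @[n --> \oo] --> r.
  by rewrite -[X in _ --> X]addr0; apply: cvgD => //; exact: cvg_cst.
have qcvg : q n @[n --> \oo] --> s.
  rewrite -[X in _ --> X]subr0 -(mulr0 2); apply: cvgB; first exact: cvg_cst.
  exact: cvgMr.
have side n : [/\ A < p n, p n + e n <= q n & q n + e n < B].
  by have := e0 n; have := e4 n; rewrite /p /q => ? ?; split; lra.
have hp : \int[mu]_(v in `]A, B[) (h v * stent (p n) (e n) v) @[n --> \oo] --> h r.
  apply: cvg_Rintegral_stent => //; first by apply/andP; split; lra.
    by move=> n; have [/ltW] := side n.
  by move=> n; have [_ ? ?] := side n; have := e0 n; lra.
have hq : \int[mu]_(v in `]A, B[) (h v * stent (q n) (e n) v) @[n --> \oo] --> h s.
  apply: cvg_Rintegral_stent => //; first by apply/andP; split; lra.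
    by move=> n; have [? ? _] := side n; have := e0 n; lra.
  by move=> n; have [_ _ /ltW] := side n.
pose chi n v := sstep (p n) (e n) v - sstep (q n) (e n) v.
have kchi : \int[mu]_(v in `]A, B[) (k v * chi n v) @[n --> \oo] -->
    \int[mu]_(v in `]A, B[) (k \_ `]r, s[) v.
  have ik : mu.-integrable `]A, B[ (EFin \o (k \_ `]r, s[)).
    rewrite -restrict_EFin; apply/integrable_restrict => //.
    rewrite setIidr; last by apply: subset_itv; rewrite bnd_simp.
    exact: in_Linfty_integrable (in_LinftyS Ar sB kL).
  rewrite /Rintegral; apply: fine_cvg; rewrite fineK; last exact: integrable_fin_num.
  have iabsk := integrable_abse (in_Linfty_integrable kL).
  have kchiL n : in_Linfty A B (fun v => k v * chi n v).
    apply: in_LinftyM => //; apply: in_LinftyB; apply: continuous_in_Linfty.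
    - exact: is_derive_continuous (is_derive_sstep (p n) (e n)).
    - exact: is_derive_continuous (is_derive_sstep (q n) (e n)).
  have [] // := @dominated_convergence _ _ _ mu `]A, B[ _
    (fun n v => (k v * chi n v)%:E) (EFin \o (k \_ `]r, s[)) (abse \o (EFin \o k)) _ _ _ iabsk.
  - by move=> n; have /integrableP[] := in_Linfty_integrable (kchiL n).
  - by have /integrableP[] := ik.
  - apply: aeW => v _; apply: cvg_EFin; first exact: nearW.
    rewrite patchE; case: ifPn => [|/negP]; rewrite inE/= in_itv/=.
      move=> /andP[rv vs]; rewrite -[X in _ --> X]mulr1.
      apply: cvgMr; apply: cvg_near_cst; near=> n.
      (* Once [2 * e n] is less than the distance from [v] to both ends, [v] lies where the plateau
         equals 1. *)
      have en : `|0 - e n| < (Num.min (v - r) (s - v)) / 2.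
        near: n; move/cvgrPdist_lt : ecvg; apply.
        by rewrite divr_gt0// lt_min !subr_gt0 rv vs.
      rewrite sub0r normrN gtr0_norm// ltr_pdivlMr// lt_min in en.
      case/andP: en => en1 en2.
      rewrite /chi sstep_right//; last by rewrite /p; lra.
      by rewrite sstep_left ?subr0// /q; lra.
    (* Outside []r, s[] the plateau is 0 for every [n], not only in the limit. *)
    move=> /negP; rewrite negb_and -!leNgt => vrs.
    apply: cvg_near_cst; apply: nearW => n.
    rewrite /= /chi; have [_ + _] := side n; have := e0 n; rewrite /p /q => en side_n.
    case/orP: vrs => vrs.
      by rewrite !sstep_left ?subrr ?mulr0//; lra.
    by rewrite !sstep_right ?subrr ?mulr0//; lra.
  - apply: aeW => v n _ /=; rewrite lee_fin normrM ler_piMr// ler_norml.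
    rewrite /chi; have /andP[? ?] := sstep_itv (p n) (e n) v.
    by have /andP[? ?] := sstep_itv (q n) (e n) v; apply/andP; split; lra.
have E n := weak_derivative_sstep cx gL xg psiD dpsic (e0 n) (let: And3 H _ _ := side n in H)
  (let: And3 _ H _ := side n in H) (let: And3 _ _ H := side n in H).
(* By [E] the sum of the three integrals is the zero sequence, so its limit is 0 as well. *)
have : (cst 0 : R^nat) n @[n --> \oo] --> h r - h s + \int[mu]_(v in `]A, B[) (k \_ `]r, s[) v.
  by rewrite -(funext E); apply: cvgD kchi; exact: cvgB.
move=> /(cvg_unique _ (cvg_cst 0)); rewrite -Rintegral_mkcondr.
rewrite (_ : _ `&` _ = `]r, s[%classic); last first.
  by rewrite setIidr//; apply: subset_itv; rewrite bnd_simp.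
rewrite -/(h s) -/(h r) => hk.
by apply/eqP; rewrite -subr_eq0 opprB addrC; apply/eqP; rewrite [RHS]hk.
Unshelve. all: by end_near. Qed.

End weak_integration_by_parts.

(** * Almost everywhere uniqueness of the weak derivative *)

Section weak_derivative_uniqueness.
Context {R : realType}.
Local Notation mu := (@lebesgue_measure R).
Implicit Types (A B : R) (x g h d : R -> R).

(** Lebesgue differentiation: almost everywhere [d] is the derivative of its indefinite integral,
    which is constantly 0. *)
Lemma ae_eq0_Rintegral A B d : in_Linfty A B d ->
  (forall s, A < s -> s <= B -> \int[mu]_(v in `]A, s[) d v = 0) ->
  {ae mu, forall s, A < s < B -> d s = 0}.
Proof.
move=> dL d0; pose f := d \_ `]A, B[.
have fi : mu.-integrable setT (EFin \o f).
  rewrite -restrict_EFin; apply/integrable_restrict => //.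
  by rewrite setTI; exact: in_Linfty_integrable.
(* Extending [d] by zero makes the indefinite integral vanish on the whole line: the domain is empty
   for [s <= A] and is cut at [B] beyond [B]. *)
have F0 s : \int[mu]_(v in `]A, s]) f v = 0.
  rewrite -Rintegral_itv_bndo_bndc; last exact: integrableS fi.
  rewrite -Rintegral_mkcondr (_ : _ `&` _ = `]A, Num.min s B[%classic); last first.
    apply/seteqP; split => v /=; rewrite !in_itv/= lt_min.
      by move=> [/andP[-> ->] /andP[_ ->]].
    by move=> /and3P[-> -> ->].
  have [Am|mA] := ltP A (Num.min s B); first by rewrite d0// ge_min lexx orbT.
  by rewrite set_itv_ge ?Rintegral_set0// bnd_simp -leNgt.
have fis y : mu.-integrable `]A, y] (EFin \o f) by exact: integrableS fi.
have := @FTC1 R f (BRight A) fis (open_integrable_locally openT fi).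
apply: aeS => s /= Fs /andP[As sB].
have /Fs[_] : (BRight A < BRight s)%O by rewrite bnd_simp.
rewrite (_ : (fun _ => _) = cst 0); last by apply/funext => y; exact: F0.
by rewrite derive1_cst /f patchE mem_set//= in_itv/= As sB.
Qed.

(** The difference [g - h] is a weak derivative of 0. Integration by parts with [psi = 1] then makes
    its integral over every []A, s[] vanish. *)
Lemma weak_derivative_ae_unique A B x g h :
  in_Linfty A B x -> in_Linfty A B g -> in_Linfty A B h ->
  weak_derivative A B x g -> weak_derivative A B x h ->
  {ae mu, forall s, A < s < B -> g s = h s}.
Proof.
move=> xL gL hL xg xh; have ghL := in_LinftyB gL hL.
have w0 : weak_derivative A B (cst 0) (fun s => g s - h s).
  move=> phi phiT; have [phiD dphic _] := phiT.
  have phiL : in_Linfty A B phi.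
    apply: continuous_in_Linfty => s.
    by apply: differentiable_continuous; exact/derivable1_diffP.
  under eq_integral do rewrite mul0r.
  rewrite integral0; under [in RHS]eq_integral do rewrite mulrBl EFinB.
  rewrite integralB//=; last 2 first.
  - exact: in_Linfty_integrable (in_LinftyM gL phiL).
  - exact: in_Linfty_integrable (in_LinftyM hL phiL).
  have gh : (\int[mu]_(s in `]A, B[) (g s * phi s)%:E =
      \int[mu]_(s in `]A, B[) (h s * phi s)%:E)%E.
    by apply: oppe_inj; rewrite -(xg _ phiT) -(xh _ phiT).
  rewrite [X in (- (X - _))%E]gh subee ?oppe0//.
  apply: integrable_fin_num => //.
  exact: in_Linfty_integrable (in_LinftyM hL phiL).
have : {ae mu, forall s, A < s < B -> g s - h s = 0}.
  apply: ae_eq0_Rintegral => // s As sB.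
  have := @weak_derivative_ibp _ A B (cst 0) _ (cst 1) (cst 0) A s _ ghL w0
    (fun s => is_derive_cst _ _ _) _ (lexx A) As sB.
  rewrite !mul0r subrr => <-.
  - by apply: eq_Rintegral => v _; rewrite mul0r add0r mulr1.
  - by apply: continuous_subspaceT; exact: cst_continuous.
  - exact: cst_continuous.
by apply: aeS => s /= gh /gh/eqP; rewrite subr_eq0 => /eqP.
Qed.

Lemma wderivP A B x : W1infty A B x ->
  in_Linfty A B (wderiv A B x) /\ weak_derivative A B x (wderiv A B x).
Proof. by move=> [_ _ xg]; exact: xgetPex xg. Qed.

End weak_derivative_uniqueness.

(** * Splitting into stages and gluing functions at the nodes *)

Section stages.
Context {R : realType}.
Local Notation mu := (@lebesgue_measure R).
Implicit Types (A B c : R) (g h : R -> R) (t : nat -> R) (f : nat -> R -> R).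

Lemma nodes_le n t : (forall i, (i < n)%N -> t i < t i.+1) ->
  forall i j, (i <= j)%N -> (j <= n)%N -> t i <= t j.
Proof.
move=> tS i j; elim: j => [|j IH]; first by rewrite leqn0 => /eqP ->.
rewrite leq_eqVlt => /predU1P[->//|ij] jn.
by rewrite (le_trans (IH ij (ltnW jn)))// ltW// tS.
Qed.

Lemma Rintegral_stages n t h : (forall i, (i < n)%N -> t i < t i.+1) ->
  in_Linfty (t 0%N) (t n) h ->
  \int[mu]_(s in `]t 0%N, t n[) h s =
  \sum_(i < n) \int[mu]_(s in `]t i, t i.+1[) h s.
Proof.
elim: n => [|n IH] tS hL.
  by rewrite big_ord0 set_itv_ge ?Rintegral_set0// bnd_simp ltxx.
have t0n : t 0%N <= t n by apply: (nodes_le tS).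
have tn := tS n (ltnSn n).
have hLn : in_Linfty (t 0%N) (t n) h by apply: in_LinftyS hL => //; exact: ltW.
rewrite big_ord_recr/= -IH//; last by move=> i /ltnW /tS.
rewrite -(@Rintegral_itvB _ h (BRight (t 0%N)) (BLeft (t n.+1)) (t n)).
- rewrite (@Rintegral_itv_bndo_bndc _ (BRight (t 0%N)) (t n)); last first.
    exact: in_Linfty_integrable.
  by rewrite [RHS]addrC subrK.
- exact: in_Linfty_integrable.
- by rewrite bnd_simp.
- by rewrite bnd_simp.
Qed.

(** There are [n + 1] pieces and only the breakpoints [t 1, ..., t n]. A breakpoint belongs to the
    piece on its left; the first piece extends to the left without bound and the last one to the
    right. *)
Fixpoint piecewise f t n : R -> R :=
  if n is n'.+1 then fun s => if s <= t n then piecewise f t n' s else f n s else f 0%N.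

Lemma piecewiseE f t n i s : (forall j, (j < n)%N -> t j < t j.+1) -> (i <= n)%N ->
  ((0 < i)%N -> t i < s) -> ((i < n)%N -> s <= t i.+1) -> piecewise f t n s = f i s.
Proof.
elim: n => [|n IH] tS; first by rewrite leqn0 => /eqP ->.
rewrite leq_eqVlt => /predU1P[-> lo _|il lo hi] /=.
  by rewrite leNgt lo.
rewrite (le_trans (hi il))//; last by apply: (nodes_le tS).
apply: IH => //; first by move=> j /ltnW /tS.
by move=> ?; apply: hi; exact: ltnW.
Qed.

Lemma continuous_piecewise f t n : (forall i, (i < n)%N -> t i < t i.+1) ->
  (forall i, continuous (f i)) ->
  (forall i, (i < n)%N -> f i (t i.+1) = f i.+1 (t i.+1)) ->
  continuous (piecewise f t n).
Proof.
move=> + fc; elim: n => [|n IH] tS ft /=; first exact: fc.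
have pc : continuous (piecewise f t n).
  by apply: IH => i /ltnW; [exact: tS|exact: ft].
set c := t n.+1.
have pf : piecewise f t n c = f n.+1 c.
  rewrite -ft//; apply: piecewiseE => //; first by move=> j /ltnW /tS.
  by move=> _; exact: tS.
(* Truncating the arguments at [c] with [min] and [max] writes the glued function as a sum of
   composites of continuous functions. *)
rewrite (_ : (fun _ => _) = (fun s =>
  piecewise f t n (Num.min s c) + f n.+1 (Num.max s c) - f n.+1 c)); last first.
  apply/funext => s; case: (leP s c) => sc; first by rewrite addrK.
  by rewrite pf addrAC subrr add0r.
move=> s; apply: cvgB; last exact: cvg_cst.
apply: cvgD.
  apply: (@continuous_comp _ _ _ (fun s => Num.min s c) (piecewise f t n)); last exact: pc.
  by apply: continuous_min; [exact: cvg_id|exact: cvg_cst].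
apply: (@continuous_comp _ _ _ (fun s => Num.max s c) (f n.+1)); last exact: fc.
by apply: continuous_max; [exact: cvg_id|exact: cvg_cst].
Qed.

Lemma in_Linfty_piecewise A B f t n : (forall i, in_Linfty A B (f i)) ->
  in_Linfty A B (piecewise f t n).
Proof.
move=> fL; elim: n => [|n IH] /=; first exact: fL.
have /in_LinftyP[mg [M gM]] := IH.
have /in_LinftyP[mh [N hN]] := fL n.+1.
apply/in_LinftyP; split.
  apply: measurable_fun_if => //.
  - by apply: measurable_fun_ler => //; exact: measurable_cst.
  - exact: measurable_funS mg.
  - exact: measurable_funS mh.
exists (Num.max M N); apply: aeS2 gM hN => s gs hs sab.
by case: ifPn => _; rewrite le_max ?gs ?hs ?orbT.
Qed.

End stages.

(** * The closed-form residual and state on a single stage *)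

Section skeleton.
Context {R : realType}.
Local Notation mu := (@lebesgue_measure R).
Variables (n : nat) (t z : nat -> R) (a : R).
Hypotheses (t_incr : forall i, (i < n.+1)%N -> t i < t i.+1) (a_neq0 : a != 0).

Let f : R -> R -> R := fun x _ => a * x.

(** The multiple of [expR (- a * s)] whose amplitude steers [x' = a x + u] from [z i] at [t i] to
    [z i.+1] at [t i.+1]. *)
Definition opt_residual i (s : R) : R :=
  - 2 * a * ((z i.+1 - expR (a * (t i.+1 - t i)) * z i)
             / (1 - expR (2 * a * (t i.+1 - t i)))) * expR (a * (t i.+1 - s)).

(** A solution of [x' = a x] plus the particular solution [- u / (2 a)] of [x' = a x + u], available
    because [u' = - a u]. *)
Definition opt_stage i (s : R) : R :=
  - ((z i.+1 - expR (- a * (t i.+1 - t i)) * z i)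
     / (expR (- a * (t i.+1 - t i)) - expR (a * (t i.+1 - t i))))
    * expR (a * (s - t i)) - (2 * a)^-1 * opt_residual i s.

Lemma is_derive_expR_affine (b c s : R) :
  is_derive s 1 (fun s => expR (b * s + c)) (b * expR (b * s + c)).
Proof.
have D : is_derive s 1 (fun s => b * s + c) b.
  have := is_deriveD (is_deriveZ b (is_derive_id s 1)) (is_derive_cst c s 1).
  by rewrite addr0 /GRing.scale/= mulr1.
rewrite mulrC; exact: @is_derive1_comp R expR _ s _ _ (is_derive_expR _) D.
Qed.

Lemma continuous_expR_affine (b c : R) : continuous (fun s => expR (b * s + c)).
Proof.
exact: is_derive_continuous (is_derive_expR_affine b c).
Qed.

(** Separates the constant amplitude from the time dependence; the [+ 0] fits the exponent to the
    affine form [b * s + c]. *)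
Lemma opt_residualE i s : opt_residual i s =
  opt_residual i 0 * expR (- a * s + 0).
Proof.
rewrite /opt_residual subr0 addr0 -[RHS]mulrA -expRD; congr (_ * expR _); ring.
Qed.

Lemma opt_stageE i s : opt_stage i s =
  - ((z i.+1 - expR (- a * (t i.+1 - t i)) * z i)
     / (expR (- a * (t i.+1 - t i)) - expR (a * (t i.+1 - t i))))
    * expR (a * s + - (a * t i)) - (2 * a)^-1 * opt_residual i s.
Proof. by rewrite /opt_stage; congr (_ * expR _ - _); ring. Qed.

Lemma is_derive_opt_residual i (s : R) :
  is_derive s 1 (opt_residual i) (- a * opt_residual i s).
Proof.
rewrite (funext (opt_residualE i)).
have := is_deriveZ (opt_residual i 0) (is_derive_expR_affine (- a) 0 s).
by rewrite /GRing.scale/= mulrCA.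
Qed.

Lemma is_derive_opt_stage i (s : R) :
  is_derive s 1 (opt_stage i) (a * opt_stage i s + opt_residual i s).
Proof.
set k := - ((z i.+1 - expR (- a * (t i.+1 - t i)) * z i)
     / (expR (- a * (t i.+1 - t i)) - expR (a * (t i.+1 - t i)))).
have := is_deriveB (is_deriveZ k (is_derive_expR_affine a (- (a * t i)) s))
  (is_deriveZ (2 * a)^-1 (is_derive_opt_residual i s)).
rewrite [X in _ -> is_derive _ _ X _](funext (opt_stageE i)) => D; apply: (is_derive_eq D).
by rewrite /GRing.scale/= opt_stageE -/k; field.
Qed.

Lemma continuous_opt_residual i : continuous (opt_residual i).
Proof.
exact: is_derive_continuous (is_derive_opt_residual i).
Qed.

Lemma continuous_opt_stage i : continuous (opt_stage i).
Proof.
exact: is_derive_continuous (is_derive_opt_stage i).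
Qed.

(** Makes the denominators of both closed forms nonzero: with [w] the exponential, they are
    [1 - w ^+ 2] and [(1 - w ^+ 2) / w]. *)
Let expR_neq1 i : (i < n.+1)%N -> expR (a * (t i.+1 - t i)) ^+ 2 != 1.
Proof.
move=> iN; have L0 : 0 < t i.+1 - t i by rewrite subr_gt0 t_incr.
rewrite -expRM_natl -[X in _ != X]expR0; apply/eqP => /expR_inj/eqP.
by rewrite !mulf_eq0 (gt_eqF L0) (negPf a_neq0) pnatr_eq0.
Qed.

(** In terms of [w = expR (a * (t i.+1 - t i))] all exponentials are powers of [w], which leaves a
    rational identity. *)
Lemma opt_stage_left i : (i < n.+1)%N -> opt_stage i (t i) = z i.
Proof.
move=> /expR_neq1; rewrite /opt_stage /opt_residual subrr mulr0 expR0 (mulNr a) expRN.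
rewrite -(mulrA 2) expRM_natl.
have := expR_gt0 (a * (t i.+1 - t i)); set w := expR _ => w0 w1.
by field; rewrite a_neq0 (gt_eqF w0) subr_eq0 eq_sym w1.
Qed.

Lemma opt_stage_right i : (i < n.+1)%N -> opt_stage i (t i.+1) = z i.+1.
Proof.
move=> /expR_neq1; rewrite /opt_stage /opt_residual subrr mulr0 expR0 (mulNr a) expRN.
rewrite -(mulrA 2) expRM_natl.
have := expR_gt0 (a * (t i.+1 - t i)); set w := expR _ => w0 w1.
by field; rewrite a_neq0 (gt_eqF w0) subr_eq0 eq_sym w1.
Qed.

(** * The glued interpolant: feasibility and residual *)

Definition interpolant : R -> R := piecewise opt_stage t n.

Let t_incrS i : (i < n)%N -> t i < t i.+1.
Proof. by move=> /ltnW; exact: t_incr. Qed.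

Lemma interpolantE i s : (i < n.+1)%N -> t i <= s <= t i.+1 ->
  interpolant s = opt_stage i s.
Proof.
move=> iN /andP[]; rewrite le_eqVlt => /predU1P[<-{s} _|tis sti]; last exact: piecewiseE.
case: i iN => [|i] iN; first by apply: piecewiseE => //; rewrite ltW ?t_incr.
(* At an interior node [piecewise] selects the preceding stage, whose final value is the same
   skeleton value. *)
rewrite opt_stage_left// -opt_stage_right; last exact: ltnW.
by apply: piecewiseE => //; [exact: ltnW|move=> _; apply: t_incr; exact: ltnW].
Qed.

Lemma continuous_interpolant : continuous interpolant.
Proof.
apply: continuous_piecewise => //; first exact: continuous_opt_stage.
by move=> i iN; rewrite opt_stage_left// opt_stage_right// ltnW.
Qed.

Definition interpolant_deriv : R -> R :=
  piecewise (fun i s => a * opt_stage i s + opt_residual i s) t n.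

Lemma in_Linfty_interpolant_deriv A B : in_Linfty A B interpolant_deriv.
Proof.
apply: in_Linfty_piecewise => i; apply: continuous_in_Linfty => s.
apply: cvgD; last exact: continuous_opt_residual.
by apply: cvgMr; exact: continuous_opt_stage.
Qed.

(** On each stage the product with [phi] is integrated classically. Neighbouring stages share the
    value [z i] at their node, so the boundary terms telescope, and [phi] vanishes at the two outer
    ends. *)
Lemma weak_derivative_interpolant :
  weak_derivative (t 0%N) (t n.+1) interpolant interpolant_deriv.
Proof.
move=> phi [phiD dphic [K [_ Kt phiK]]].
have phi0 s : ~~ (t 0%N < s < t n.+1) -> phi s = 0.
  by move=> /negP st; apply: phiK => /Kt; rewrite /= in_itv.
have phic : continuous phi.
  by move=> s; apply: differentiable_continuous; exact/derivable1_diffP.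
pose L (g : R -> R) (gc : continuous g) := continuous_in_Linfty (t 0%N) (t n.+1) gc.
have L1 := in_LinftyM (L _ continuous_interpolant) (L _ dphic).
have L2 := in_LinftyM (in_Linfty_interpolant_deriv _ _) (L _ phic).
have I1 := in_Linfty_integrable L1; have I2 := in_Linfty_integrable L2.
rewrite -[LHS]fineK ?integrable_fin_num// -[X in (- X)%E]fineK ?integrable_fin_num//.
rewrite -EFinN; congr EFin; apply/eqP; rewrite -addr_eq0; apply/eqP.
rewrite -/(Rintegral _ _ (fun s => interpolant s * phi^`()%classic s)).
rewrite -/(Rintegral _ _ (fun s => interpolant_deriv s * phi s)).
rewrite -RintegralD// Rintegral_stages//; last exact: in_LinftyD L1 L2.
transitivity (\sum_(i < n.+1) (z i.+1 * phi (t i.+1) - z i * phi (t i))).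
  apply: eq_bigr => i _.
  pose D s := opt_stage i s * phi^`()%classic s +
    (a * opt_stage i s + opt_residual i s) * phi s.
  transitivity (\int[mu]_(s in `]t i, t i.+1[) D s).
    apply: eq_Rintegral => s; rewrite inE/= in_itv/= => /andP[tis sti].
    rewrite (interpolantE (ltn_ord i)) ?ltW//.
    by rewrite /interpolant_deriv (@piecewiseE _ _ _ _ i) ?ltW// -ltnS.
  have DD (s : R) : is_derive s 1 (fun s => opt_stage i s * phi s) (D s).
    have D1 := is_derive_opt_stage i s.
    have D2 : is_derive s 1 phi (phi^`()%classic s) by rewrite derive1E; exact/derivableP.
    apply: (is_derive_eq (is_deriveM D1 D2)).
    by rewrite /D /GRing.scale/= [in RHS](mulrC _ (phi s)).
  have Dc : continuous D.
    move=> s; apply: cvgD; apply: cvgM;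
      [exact: continuous_opt_stage|exact: dphic| |exact: phic].
    apply: cvgD; last exact: continuous_opt_residual.
    by apply: cvgMr; exact: continuous_opt_stage.
  by rewrite (Rintegral_FTC (t_incr (ltn_ord i)) DD Dc) opt_stage_left// opt_stage_right.
rewrite -(big_mkord xpredT (fun i => z i.+1 * phi (t i.+1) - z i * phi (t i))).
rewrite (telescope_sumr (fun i => z i * phi (t i)))//.
by rewrite !phi0 ?ltxx ?andbF// !mulr0 subrr.
Qed.

Lemma node_bounds i : (i < n.+1)%N -> t 0%N <= t i /\ t i.+1 <= t n.+1.
Proof. by move=> iN; split; apply: (nodes_le t_incr) => //; exact: ltnW. Qed.

Lemma interpolant_feasible : PL2_feasible n.+1 t z interpolant.
Proof.
split; last first.
  move=> [|i] iN; first by rewrite (@interpolantE 0) ?opt_stage_left// lexx ltW ?t_incr.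
  by rewrite (@interpolantE i) ?opt_stage_right// lexx ltW ?t_incr.
split.
- by apply: continuous_subspaceT; exact: continuous_interpolant.
- by apply: continuous_in_Linfty; exact: continuous_interpolant.
- by exists interpolant_deriv; split;
    [exact: in_Linfty_interpolant_deriv|exact: weak_derivative_interpolant].
Qed.

Lemma interpolant_residual : has_residual n.+1 t f interpolant opt_residual.
Proof.
move=> i iN; have [W _] := interpolant_feasible; have [_ xL _] := W.
have [gL xg] := wderivP W; have [t0i tin] := node_bounds iN.
have gG := weak_derivative_ae_unique xL gL
  (in_Linfty_interpolant_deriv _ _) xg weak_derivative_interpolant.
(* The ends of the stage are discarded: at [t i] the glued derivative may belong to the preceding
   stage, and the uniqueness result covers only the open interval. *)
have neq c : {ae mu, forall s, s != c}.
  exists [set c]; split => //; first exact: lebesgue_measure_set1.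
  by move=> s /= /negP; rewrite negbK => /eqP.
apply: aeS2 (neq (t i.+1)) (aeS2 _ (neq (t i)) gG); last first.
  by move=> s s1 s2; exact: (conj s1 s2).
move=> s s1 [s0 gs]; rewrite in_itv/= => /andP[tis sti].
have tis' : t i < s by rewrite lt_neqAle eq_sym s0.
have sti' : s < t i.+1 by rewrite lt_neqAle s1.
rewrite /residual gs; last first.
  by rewrite (le_lt_trans t0i tis') (lt_le_trans sti' tin).
rewrite (interpolantE iN) ?tis// /interpolant_deriv (@piecewiseE _ _ _ _ i)//.
by rewrite /f addrAC subrr add0r.
Qed.

(** * Optimality, and recovery of the state from its residual *)

Lemma residual_ibp y r s : W1infty (t 0%N) (t n.+1) y ->
  t 0%N <= r -> r < s -> s <= t n.+1 ->
  \int[mu]_(v in `]r, s[) (residual f (t 0%N) (t n.+1) y v * expR (- a * v + 0)) =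
  y s * expR (- a * s + 0) - y r * expR (- a * r + 0).
Proof.
move=> W t0r rs stn; have [yc _ _] := W; have [gL yg] := wderivP W.
(* The integrating factor [psi = expR (- a * v)] has [psi' = - a psi], which turns [y psi' + y' psi]
   into the residual times [psi]. *)
rewrite -(@weak_derivative_ibp _ _ _ _ _ _ _ _ _ yc gL yg (is_derive_expR_affine (- a) 0))//.
  by apply: eq_Rintegral => v _; rewrite /residual /f; ring.
by move=> v; apply: cvgMr; exact: continuous_expR_affine.
Qed.

Lemma in_Linfty_residual y i : (i < n.+1)%N -> W1infty (t 0%N) (t n.+1) y ->
  in_Linfty (t i) (t i.+1) (residual f (t 0%N) (t n.+1) y).
Proof.
move=> iN W; have [yc yL _] := W; have [gL _] := wderivP W.
have [t0i tin] := node_bounds iN.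
apply: (in_LinftyS t0i tin); apply: in_LinftyB => //.
by apply: in_LinftyM => //; apply: continuous_in_Linfty; exact: cst_continuous.
Qed.

Lemma ae_eq_Rintegral c d g h : c < d -> in_Linfty c d g -> in_Linfty c d h ->
  {ae mu, forall s, s \in `[c, d] -> g s = h s} ->
  \int[mu]_(s in `]c, d[) g s = \int[mu]_(s in `]c, d[) h s.
Proof.
move=> cd /in_LinftyP[mg _] /in_LinftyP[mh _] gh; congr fine.
apply: ae_eq_integral => //; [exact/measurable_EFinP|exact/measurable_EFinP|].
apply: aeS gh => s /= gh; rewrite in_itv/= => /andP[cs sd].
by rewrite gh// in_itv/= !ltW.
Qed.

(* rho is a multiple of exp(-a s), and exp(-a s) (v - rho) is the derivative of
   exp(-a s) (y - interpolant), which vanishes at both ends of the stage. *)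
Lemma Rintegral_first_variation y i : (i < n.+1)%N -> PL2_feasible n.+1 t z y ->
  let rho := residual f (t 0%N) (t n.+1) interpolant in
  let v := residual f (t 0%N) (t n.+1) y in
  \int[mu]_(s in `]t i, t i.+1[) (rho s * (v s - rho s)) = 0.
Proof.
move=> iN [yW yz] rho v; have [xW xz] := interpolant_feasible.
have [t0i tin] := node_bounds iN; have ti := t_incr iN.
have rhoL : in_Linfty (t i) (t i.+1) rho := in_Linfty_residual iN xW.
have vL : in_Linfty (t i) (t i.+1) v := in_Linfty_residual iN yW.
have EL : in_Linfty (t i) (t i.+1) (fun s => expR (- a * s + 0)).
  by apply: continuous_in_Linfty; exact: continuous_expR_affine.
have uL : in_Linfty (t i) (t i.+1) (opt_residual i).
  by apply: continuous_in_Linfty; exact: continuous_opt_residual.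
have vrL := in_LinftyB vL rhoL.
(* Only the left factor becomes explicit: its amplitude can then be pulled out, while [v - rho]
   stays in the form to which [residual_ibp] applies. *)
rewrite (@ae_eq_Rintegral _ _ _ (fun s => opt_residual i s * (v s - rho s)))//; last 3 first.
- exact: in_LinftyM rhoL vrL.
- exact: in_LinftyM uL vrL.
- by apply: aeS (interpolant_residual iN) => s /= rs /rs rho_u; rewrite -rho_u.
have iv := in_Linfty_integrable (in_LinftyM vL EL).
have ir := in_Linfty_integrable (in_LinftyM rhoL EL).
have ivr := in_Linfty_integrable (in_LinftyB (in_LinftyM vL EL) (in_LinftyM rhoL EL)).
transitivity (\int[mu]_(s in `]t i, t i.+1[) (opt_residual i 0 *
    (v s * expR (- a * s + 0) - rho s * expR (- a * s + 0)))).
  by apply: eq_Rintegral => s _; rewrite opt_residualE; ring.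
rewrite RintegralZl// RintegralB// !residual_ibp//.
by rewrite !xz ?yz ?subrr ?mulr0// ltnW.
Qed.

(** Expanding [v^2 = rho^2 + 2 rho (v - rho) + (v - rho)^2], the middle term integrates to 0 and the
    last is nonnegative. *)
Lemma le_stage_cost y i : (i < n.+1)%N -> PL2_feasible n.+1 t z y ->
  (\int[mu]_(s in `[t i, t i.+1])
     (`|residual f (t 0%N) (t n.+1) interpolant s| ^+ 2)%:E <=
   \int[mu]_(s in `[t i, t i.+1])
     (`|residual f (t 0%N) (t n.+1) y s| ^+ 2)%:E)%E.
Proof.
move=> iN yF; have := Rintegral_first_variation iN yF.
set rho := residual _ _ _ interpolant; set v := residual _ _ _ y => /= var0.
have rhoL : in_Linfty (t i) (t i.+1) rho := in_Linfty_residual iN interpolant_feasible.1.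
have vL : in_Linfty (t i) (t i.+1) v := in_Linfty_residual iN yF.1.
have rvL := in_LinftyM rhoL (in_LinftyB vL rhoL).
have rrL := in_LinftyM rhoL rhoL; have vvL := in_LinftyM vL vL.
(* Passes from extended integrals over the closed stage to real ones over the open stage, where
   linearity is available. *)
have sq (g : R -> R) : in_Linfty (t i) (t i.+1) g ->
    (\int[mu]_(s in `[t i, t i.+1]) (`|g s| ^+ 2)%:E =
     (\int[mu]_(s in `]t i, t i.+1[) (g s * g s))%:E)%E.
  move=> gL; have ggL := in_LinftyM gL gL.
  under eq_integral do rewrite real_normK ?num_real// expr2.
  rewrite integral_itv_bndoo; last by have /in_LinftyP[/measurable_EFinP] := ggL.
  by rewrite /Rintegral fineK//; apply: integrable_fin_num => //; exact: in_Linfty_integrable.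
rewrite !sq// lee_fin.
have irv := in_Linfty_integrable rvL; have irr := in_Linfty_integrable rrL.
have ivv := in_Linfty_integrable vvL.
(* The vanishing first variation is added twice on the left, which reduces the claim to the
   pointwise bound [rho^2 + 2 rho (v - rho) <= v^2]. *)
rewrite -[leLHS]addr0 -[X in _ + X](addr0 0) -{1}var0 -{1}var0.
rewrite -RintegralD// -RintegralD//; last first.
  exact: in_Linfty_integrable (in_LinftyD rvL rvL).
apply: le_Rintegral => //.
  exact: in_Linfty_integrable (in_LinftyD rrL (in_LinftyD rvL rvL)).
by move=> s _; have := sqr_ge0 (v s - rho s); rewrite expr2; nra.
Qed.

Lemma interpolant_solution : PL2_solution n.+1 t z f interpolant.
Proof.
split; first exact: interpolant_feasible.
move=> y yF; rewrite /PL2_cost lee_pmul2l// ?lte_fin ?invr_gt0//.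
by apply: lee_sum => i _; exact: le_stage_cost.
Qed.

(** On []t i, s[] both [x] and [interpolant] satisfy the integrated identity with the same residual
    and the same initial value [z i]; cancelling the positive exponential at [s] gives equality. *)
Lemma residual_uniqueness x i s : PL2_feasible n.+1 t z x ->
  has_residual n.+1 t f x opt_residual -> (i < n.+1)%N ->
  t i <= s <= t i.+1 -> x s = opt_stage i s.
Proof.
move=> xF xu iN /[dup] tisti /andP[]; rewrite le_eqVlt => /predU1P[<- _|tis sti].
  by rewrite opt_stage_left//; apply: xF.2; exact: ltnW.
rewrite -interpolantE//; have [t0i tin] := node_bounds iN.
have EL c d : in_Linfty c d (fun s => expR (- a * s + 0)).
  by apply: continuous_in_Linfty; exact: continuous_expR_affine.
have ibp y : PL2_feasible n.+1 t z y -> has_residual n.+1 t f y opt_residual ->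
    \int[mu]_(v in `]t i, s[) (opt_residual i v * expR (- a * v + 0)) =
    y s * expR (- a * s + 0) - z i * expR (- a * t i + 0).
  move=> [yW yz] yu; rewrite -yz ?(ltnW iN)// -residual_ibp//; last exact: le_trans tin.
  apply: ae_eq_Rintegral => //.
  - by apply: in_LinftyM => //; apply: continuous_in_Linfty; exact: continuous_opt_residual.
  - by apply: in_LinftyM => //; exact: in_LinftyS (in_Linfty_residual iN yW).
  - apply: aeS (yu i iN) => r /= ru; rewrite in_itv/= => /andP[tir rs].
    by rewrite ru// in_itv/= tir (le_trans rs).
have := ibp _ interpolant_feasible interpolant_residual.
rewrite (ibp _ xF xu) => /addIr; apply: mulIf.
by rewrite gt_eqF// expR_gt0.
Qed.

End skeleton.

Theorem proposition1 (R : realType) (N : nat) (t z : nat -> R) (a : R)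
  (N_gt0 : (0 < N)%N)
  (t_start : t 0%N = 0)
  (t_incr : forall i, (i < N)%N -> t i < t i.+1)
  (z_neq : forall i, (i < N)%N -> z i.+1 != z i)
  (a_neq0 : a != 0) :
  let f : R -> R -> R := fun x _ => a * x in
  let u : nat -> R -> R := fun i s =>
    - 2 * a * ((z i.+1 - expR (a * (t i.+1 - t i)) * z i)
               / (1 - expR (2 * a * (t i.+1 - t i))))
      * expR (a * (t i.+1 - s)) in
  (exists x, PL2_solution N t z f x /\ has_residual N t f x u) /\
  (forall x, PL2_feasible N t z x -> has_residual N t f x u ->
     forall i, (i < N)%N -> forall s, s \in `[t i, t i.+1] ->
       x s = - ((z i.+1 - expR (- a * (t i.+1 - t i)) * z i)
                / (expR (- a * (t i.+1 - t i)) - expR (a * (t i.+1 - t i))))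
               * expR (a * (s - t i))
             - (2 * a)^-1 * u i s).
Proof.
(* With [N = n.+1] the stages are numbered [0, ..., n], so that [n] is the index of the last piece
   in [piecewise]. *)
case: N N_gt0 t_incr {z_neq} => // n _ t_incr f u; split.
  exists (interpolant n t z a); split.
    exact: (interpolant_solution z t_incr a_neq0).
  exact: (interpolant_residual z t_incr a_neq0).
move=> x xF xu i iN s; rewrite in_itv/=.
exact: (residual_uniqueness t_incr a_neq0 xF xu iN).
Qed.
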